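(* Let the constrained optimization problem $\max_{\mathbf{x}} f(\mathbf{x},\mathbf{a})$ subject to $g^{k}(\mathbf{x},\mathbf{a})=0$, $k=1,\dots,K$, its solution $\mathbf{x}(\mathbf{a})$, the multipliers $\lambda_k(\mathbf{a})$ and a set of generalized compensated derivatives $D_1,\dots,D_A$ with respect to the constraint functions be as described in the context. Then for every $\mathbf{a}\in\mathcal{P}$ the $A\times A$ matrix $$\Omega_{\alpha\beta}(\mathbf{a})=\sum_{i=1}^{M}x_{i;\beta}(\mathbf{a})\Big[f_{,i;\alpha}(\mathbf{x}(\mathbf{a}),\mathbf{a})+\sum_{k=1}^{K}\lambda_k(\mathbf{a})\,g^{k}_{,i;\alpha}(\mathbf{x}(\mathbf{a}),\mathbf{a})\Big]$$ is symmetric and positive semidefinite (free of constraints: $\sum_{\alpha,\beta}\eta_\alpha\Omega_{\alpha\beta}(\mathbf{a})\eta_\beta\ge 0$ for all $\eta\in\mathbb{R}^A$); that is, $\Omega$ is a comparative statics matrix of the problem.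
   Context: Setting. $\mathcal{P}\subset\mathbb{R}^N$ is open (parameter space), $\mathcal{D}\subset\mathbb{R}^M$ (decision space), $M,N>K$, and $f,g^1,\dots,g^K$ are real-valued functions of $(\mathbf{x},\mathbf{a})$, twice continuously differentiable on an open set containing $\mathcal{D}\times\mathcal{P}$. For each $\mathbf{a}\in\mathcal{P}$ consider $\max_{\mathbf{x}\in\mathcal{D}} f(\mathbf{x},\mathbf{a})$ subject to $g^k(\mathbf{x},\mathbf{a})=0$, $k=1,\dots,K$. It is assumed that there is a continuously differentiable function $\mathbf{x}(\cdot):\mathcal{P}\to\mathcal{D}$ (the decision function) such that for each $\mathbf{a}\in\mathcal{P}$ the point $\mathbf{x}(\mathbf{a})$ lies in the interior of $\mathcal{D}$ and is the unique solution of the problem. The constraints are assumed independent at the optimum: for each $\mathbf{a}$ the $K$ parameter-space gradients $\nabla^{\mathbf{a}}g^k(\mathbf{x}(\mathbf{a}),\mathbf{a})$ are linearly independent, and the $K$ decision-space gradients $\nabla^{\mathbf{x}}g^k(\mathbf{x}(\mathbf{a}),\mathbf{a})$ are linearly independent. The Lagrange multipliers $\lambda_k(\mathbf{a})$ are the scalars with $f_{,i}(\mathbf{x}(\mathbf{a}),\mathbf{a})=-\sum_{k}\lambda_k(\mathbf{a})g^k_{,i}(\mathbf{x}(\mathbf{a}),\mathbf{a})$, $i=1,\dots,M$. Notation. A Latin subscript after a comma is a partial derivative with respect to a decision variable ($\phi_{,i}=\partial\phi/\partial x_i$). Isovectors $\mathbf{t}^\alpha=\mathbf{t}^\alpha(\mathbf{x},\mathbf{a})\in\mathbb{R}^N$,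 $\alpha=1,\dots,A$, are vectors with $\mathbf{t}^\alpha\cdot\nabla^{\mathbf{a}}g^k(\mathbf{x},\mathbf{a})=0$ for all $k$ and all $(\mathbf{x},\mathbf{a})$, linearly independent and spanning the orthogonal complement of the parameter-space gradients of the $g^k$. The corresponding generalized compensated derivatives (GCD's) are $D_\alpha(\mathbf{x},\mathbf{a})=\sum_{\mu=1}^N t^\alpha_\mu(\mathbf{x},\mathbf{a})\,\partial/\partial a_\mu$, and $D_\alpha(\mathbf{a})=D_\alpha(\mathbf{x}(\mathbf{a}),\mathbf{a})$. A Greek subscript after a semicolon denotes application of a GCD: $x_{i;\alpha}(\mathbf{a})=\sum_\mu t^\alpha_\mu(\mathbf{x}(\mathbf{a}),\mathbf{a})\,\partial x_i(\mathbf{a})/\partial a_\mu$, and, for a function $\phi(\mathbf{x},\mathbf{a})$, $\phi_{,i;\alpha}=\sum_\mu t^\alpha_\mu\,\partial(\phi_{,i})/\partial a_\mu$ (with $\mathbf{x}$ held fixed in the differentiation). A comparative statics matrix is a matrix whose entries are linear combinations of the partial derivatives $\partial x_i/\partial a_\mu$ of the decision functions and which is symmetric and semidefinite, with no restriction on the vectors in the quadratic form. *)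

(* Defs.v *)
From HB Require Import structures.
From mathcomp Require Import all_boot all_order all_algebra.
From mathcomp Require Import all_classical all_reals all_analysis.

Set Implicit Arguments.
Unset Strict Implicit.
Unset Printing Implicit Defensive.

Import Order.TTheory GRing.Theory Num.Theory.
Import numFieldNormedType.Exports.

Local Open Scope classical_set_scope.
Local Open Scope ring_scope.

(* Used on open sets of finite-dimensional spaces only: continuity of the
   differential is expressed vector by vector, which in finite dimension is
   the same as continuity in operator norm. *)
Definition C1_on (R : realType) (V W : normedModType R)
    (U : set V) (F : V -> W) : Prop :=
  forall z, U z ->
    differentiable F z /\ forall v, {for z, continuous (fun y => 'D_v F y)}.

Definition C2_on (R : realType) (V W : normedModType R)
    (U : set V) (F : V -> W) : Prop :=
  C1_on U F /\ forall v, C1_on U (fun y => 'D_v F y).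

(* Functions of decision variables x and parameters a are functions of the
   pair z = (x, a). *)
Notation point R M N := ('rV[R]_M * 'rV[R]_N)%type.

Section Definitions.
Context {R : realType} {M N K A : nat}.
Implicit Types (D : set 'rV[R]_M) (phi f : point R M N -> R)
  (g : 'I_K -> point R M N -> R) (t : 'I_A -> point R M N -> 'rV[R]_N)
  (z : point R M N) (a : 'rV[R]_N) (x : 'rV[R]_N -> 'rV[R]_M)
  (lam : 'rV[R]_N -> 'I_K -> R).

Definition dotv (n : nat) (u v : 'rV[R]_n) : R := \sum_(j < n) u 0 j * v 0 j.

Definition partial_x (i : 'I_M) phi z : R :=
  'D_((delta_mx 0 i, 0) : point R M N) phi z.

Definition partial_a (mu : 'I_N) phi z : R :=
  'D_((0, delta_mx 0 mu) : point R M N) phi z.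

Definition grad_x phi z : 'rV[R]_M := \row_i partial_x i phi z.

Definition grad_a phi z : 'rV[R]_N := \row_mu partial_a mu phi z.

Definition feasible D g a (y : 'rV[R]_M) : Prop :=
  D y /\ forall k, g k (y, a) = 0.

Definition solution D f g a (y : 'rV[R]_M) : Prop :=
  feasible D g a y /\ forall y', feasible D g a y' -> f (y', a) <= f (y, a).

Definition unique_solution D f g a (y : 'rV[R]_M) : Prop :=
  solution D f g a y /\ forall y', solution D f g a y' -> y' = y.

Definition multipliers f g x lam a : Prop :=
  forall i, partial_x i f (x a, a) =
            - \sum_(k < K) lam a k * partial_x i (g k) (x a, a).

Definition isovectors g t z : Prop :=
  [/\ forall al k, dotv (t al z) (grad_a (g k) z) = 0,
      row_free (\matrix_(al < A) t al z)
    & forall v : 'rV[R]_N, (forall k, dotv v (grad_a (g k) z) = 0) ->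
        (v <= \matrix_(al < A) t al z)%MS].

Definition gcd_partial t (al : 'I_A) phi z : R :=
  \sum_(mu < N) t al z 0 mu * partial_a mu phi z.

Definition partial_decision x (i : 'I_M) (mu : 'I_N) a : R :=
  'D_(delta_mx 0 mu) (fun b => x b 0 i) a.

Definition gcd_decision t x (i : 'I_M) (al : 'I_A) a : R :=
  \sum_(mu < N) t al (x a, a) 0 mu * partial_decision x i mu a.

Definition Omega f g t x lam a : 'M[R]_A :=
  \matrix_(al, be) \sum_(i < M) gcd_decision t x i be a *
    (gcd_partial t al (partial_x i f) (x a, a) +
     \sum_(k < K) lam a k * gcd_partial t al (partial_x i (g k)) (x a, a)).

(* Symmetry is not part of this predicate, and the vector eta is free of
   constraints. *)
Definition possemidef (B : 'M[R]_A) : Prop :=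
  forall eta : 'rV[R]_A,
    0 <= \sum_(al < A) \sum_(be < A) eta 0 al * B al be * eta 0 be.

Definition comparative_statics_matrix x a (B : 'M[R]_A) : Prop :=
  [/\ exists c : 'I_A -> 'I_A -> 'I_M -> 'I_N -> R, forall al be,
        B al be = \sum_(i < M) \sum_(mu < N)
                    c al be i mu * partial_decision x i mu a,
      B^T = B
    & possemidef B \/ possemidef (- B)].

End Definitions.

(* Main.v *)
Require Import Defs.
From HB Require Import structures.
From mathcomp Require Import all_boot all_order all_algebra.
From mathcomp Require Import all_classical all_reals all_analysis.

From mathcomp Require Import ring.

Set Implicit Arguments.
Unset Strict Implicit.
Unset Printing Implicit Defensive.

Import Order.TTheory GRing.Theory Num.Theory.
Import numFieldNormedType.Exports.

Local Open Scope classical_set_scope.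
Local Open Scope ring_scope.

(** Fix a parameter a, write x0 = x(a), and let L be the Lagrangian
    f + sum_k lam_k(a) g^k with the multipliers frozen at their value for a.
    Let X_w = Dx(a) w be the response of the decision to a parameter direction
    w, and call v tangent when D_v g^k = 0 at (x0, a) for all k, where D_v
    differentiates in the decision variables alone.

    Differentiating g^k(x(b), b) = 0 along an isovector t^alpha shows that
    X_alpha = X_(t^alpha) is tangent, because t^alpha is orthogonal to the
    parameter gradients.  Differentiating the first-order condition along w and
    pairing it with a tangent v gives
      L_xx(v, X_w) + L_xa(v, w) = 0;
    the derivatives of the multipliers drop out since they multiply D_v g^k = 0.
    The bracket in Omega is L_xa evaluated on t^alpha, so the two facts give
      Omega_(alpha beta) = - L_xx(X_alpha, X_beta).
    Symmetry is then Schwarz's theorem, and positivity is the second-order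
    necessary condition: L_xx is nonpositive on tangent vectors.

    Two points need care.  The multipliers lam_k(b) at nearby parameters b are
    only given pointwise, so the differentiated first-order condition comes
    from a limit of difference quotients in which they are eliminated by
    Cramer's rule ([vanishing_combination],
    [differentiated_stationarity]).  And the second-order condition needs a
    feasible curve in each tangent direction; a contraction argument produces
    feasible points x0 + s (v + o(1)) ([tangent_direction_lift]), and the
    difference quotients of DL, uniform over the perturbed directions
    ([hadamard]), turn them into the sign of L_xx(v, v)
    ([second_order_necessary]). *)

(** * Limits of finite sums and determinants *)

Section BigLimits.
Variables (R : numFieldType) (T : Type) (F : set_system T).
Hypothesis FF : Filter F.

Lemma cvg_sum_fin (W : normedModType R) (I : finType) (f : I -> T -> W) (l : I -> W) :
  (forall i, f i t @[t --> F] --> l i) ->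
  \sum_i f i t @[t --> F] --> \sum_i l i.
Proof.
move=> fl; apply: (cvg_big (P := predT) (@add_continuous W)) => i _; exact: fl.
Qed.

Lemma cvg_add_small_combination (W : normedModType R) (I : finType)
    (X : W) (b : I -> W) (c : I -> T -> R) :
  (forall i, c i t @[t --> F] --> (0 : R)) ->
  X + \sum_i c i t *: b i @[t --> F] --> X.
Proof.
move=> c0; rewrite -[X in _ --> X]addr0; apply: cvgD; first exact: cvg_cst.
rewrite [X in _ --> X](_ : 0 = \sum_i (0 : R) *: b i); last first.
  by rewrite big1// => i _; rewrite scale0r.
by apply: cvg_sum_fin => i; apply: cvgZr_tmp; exact: c0.
Qed.

Lemma cvg_det n (A : T -> 'M[R]_n) (B : 'M[R]_n) :
  (forall i j, A t i j @[t --> F] --> B i j) -> \det (A t) @[t --> F] --> \det B.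
Proof.
move=> AB; rewrite /determinant; apply: cvg_sum_fin => s.
apply: cvgM; first exact: cvg_cst.
by apply: (cvg_big (P := predT) (@mul_continuous R)) => i _; exact: AB.
Qed.

Lemma cvg_adj n (A : T -> 'M[R]_n) (B : 'M[R]_n) :
  (forall i j, A t i j @[t --> F] --> B i j) ->
  forall i j, (\adj (A t)) i j @[t --> F] --> (\adj B) i j.
Proof.
move=> AB i j; rewrite mxE /cofactor; under eq_fun do rewrite mxE /cofactor.
apply: cvgM; first exact: cvg_cst.
apply: cvg_det => k l; rewrite !mxE; under eq_fun do rewrite !mxE; exact: AB.
Qed.

End BigLimits.

(** * Directional derivatives and Schwarz's theorem *)

Section Calculus.
Variables (R : realType) (V : normedModType R).
Implicit Types (F : V -> R) (u v w z : V) (U : set V).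

Lemma deriveZv F z c v : differentiable F z -> 'D_(c *: v) F z = c * 'D_v F z.
Proof. by move=> dF; rewrite !deriveE// linearZ. Qed.

Lemma deriveDv F z u v : differentiable F z ->
  'D_(u + v) F z = 'D_u F z + 'D_v F z.
Proof. by move=> dF; rewrite !deriveE// linearD. Qed.

Lemma derive_sumv F z (I : finType) (c : I -> R) (v : I -> V) :
  differentiable F z ->
  'D_(\sum_i c i *: v i) F z = \sum_i c i * 'D_(v i) F z.
Proof.
move=> dF; rewrite deriveE// linear_sum; apply: eq_bigr => i _.
by rewrite linearZ deriveE.
Qed.

Lemma mean_value F z w :
  (forall r : R, 0 <= r <= 1 -> differentiable F (z + r *: w)) ->
  exists2 r : R, 0 < r < 1 & F (z + w) - F z = 'D_w F (z + r *: w).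
Proof.
move=> dF; pose l (r : R) := z + r *: w.
have dl r : is_diff r l ( *:%R^~ w).
  have -> : l = cst z + ( *:%R^~ w) by apply/funext.
  by apply: is_diff_eq; rewrite add0r.
have dFl (r : R) : 0 <= r <= 1 -> is_derive r 1 (F \o l) ('D_w F (l r)).
  move=> r01; have dFr := dF r r01.
  have d : differentiable (F \o l) r by
    exact: differentiable_comp (@ex_diff _ _ _ _ _ _ _ (dl r)) dFr.
  split; first exact: diff_derivable.
  rewrite deriveE// (diff_comp (@ex_diff _ _ _ _ _ _ _ (dl r)) dFr) /=.
  by rewrite (@diff_val _ _ _ _ _ _ _ (dl r)) scale1r deriveE.
have [||r r01] := @MVT R (F \o l) (fun r => 'D_w F (l r)) 0 1 ltr01.
- by move=> r; rewrite in_itv /= => /andP[r0 r1]; apply: dFl; rewrite !ltW.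
- apply: continuous_in_subspaceT => r.
  rewrite inE /= in_itv/= => /dFl[d _].
  by apply/differentiable_continuous/derivable1_diffP.
rewrite /l /= subr0 mulr1 scale1r scale0r addr0 => E.
by exists r => //; move: r01; rewrite in_itv.
Qed.

Lemma diff_remainder F z (e : R) : differentiable F z -> 0 < e ->
  \forall h \near (0 : V), `|F (z + h) - F z - 'D_h F z| <= e * `|h|.
Proof.
move=> dF e0; have := diff_locallyxC dF.
move=> /funext/eqaddoP/(_ _ e0); apply: filterS => h /=.
by rewrite deriveE// opprD addrA.
Qed.

(** A differentiable function is Hadamard differentiable: the difference
    quotient may use a varying direction.  Later the directions are those that
    reach feasible points, which only converge to the tangent direction. *)
Lemma hadamard F z X : differentiable F z -> F z = 0 ->
  p.1^-1 * F (z + p.1 *: p.2) @[p --> (0^'+, nbhs X)] --> 'D_X F z.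
Proof.
move=> dF Fz0; apply/cvgrPdist_le => e e0.
pose e1 := e / 2 / (`|X| + 1).
have X1 : 0 < `|X| + 1 by rewrite ltr_wpDl.
have e10 : 0 < e1 by rewrite !divr_gt0.
have /nbhs_ballP[d /= d0 dP] := diff_remainder dF e10.
have cD : (fun w => 'D_w F z) @ X --> 'D_X F z.
  have -> : (fun w => 'D_w F z) = 'd F z by apply/funext => w; rewrite deriveE.
  rewrite deriveE//; exact: diff_continuous.
exists ([set s | 0 < s /\ s * (`|X| + 1) < d],
        [set w | `|X - w| < 1 /\ `|'D_X F z - 'D_w F z| < e / 2]).
  split; near=> q.
  - split; near: q; first exact: nbhs_right_gt.
    under eq_near do rewrite -ltr_pdivlMr//.
    by apply: nbhs_right_lt; rewrite divr_gt0.
  - split; near: q; first by apply/nbhs_ballP; exists 1 => //= w; rewrite -ball_normE.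
    by move/cvgrPdist_lt : cD; apply; rewrite divr_gt0.
move=> [s w] [[/= s0 sd] [/= w1 wX]].
have ws : `|w| <= `|X| + 1.
  rewrite -lerBlDl (le_trans (lerB_dist _ _))// distrC ltW//.
have swd : `|s *: w| < d.
  by rewrite normrZ gtr0_norm// (le_lt_trans _ sd)// ler_pM2l.
have := dP (s *: w); rewrite -ball_normE /= sub0r normrN => /(_ swd).
rewrite Fz0 subr0 deriveZv// normrZ (gtr0_norm s0) => A.
rewrite (splitr e) -(subrK ('D_w F z) ('D_X F z)) -addrA (le_trans (ler_normD _ _))//.
rewrite lerD ?(ltW wX)//.
have -> : 'D_w F z - s^-1 * F (z + s *: w) =
   - (s^-1 * (F (z + s *: w) - s * 'D_w F z)).
  by rewrite mulrBr mulKf ?gt_eqF// opprB.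
rewrite normrN normrM gtr0_norm ?invr_gt0// ler_pdivrMl//.
rewrite (le_trans A)// mulrCA ler_pM2l//.
have <- : e1 * (`|X| + 1) = e / 2 by rewrite divfK ?gt_eqF.
by rewrite ler_pM2l.
Unshelve. all: by end_near. Qed.

Lemma differentiable_shift F z c : differentiable F (z + c) ->
  differentiable (fun y => F (y + c)) z.
Proof.
move=> dF; have dl : is_diff z (fun y => y + c) id.
  have -> : (fun y : V => y + c) = id + cst c by apply/funext.
  by apply: is_diff_eq; rewrite addr0.
exact: differentiable_comp (@ex_diff _ _ _ _ _ _ _ dl) dF.
Qed.

Lemma derive_shift_arg F z c v :
  'D_v (fun y => F (y + c)) z = 'D_v F (z + c).
Proof. by rewrite /derive /=; under eq_fun do rewrite -addrA. Qed.

(** The mean value theorem applied twice, first to the increment of F in the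
    direction u, then to the derivative of F along v. *)
Lemma second_difference F U z u v (s : R) : C2_on U F ->
  (forall r r' : R, 0 <= r <= 1 -> 0 <= r' <= 1 ->
     U (z + r *: (s *: v) + r' *: (s *: u))) ->
  exists r r', [/\ 0 <= r <= 1, 0 <= r' <= 1 &
    F (z + s *: v + s *: u) - F (z + s *: v) - F (z + s *: u) + F z =
    s ^+ 2 * 'D_u (fun y => 'D_v F y) (z + r *: (s *: v) + r' *: (s *: u))].
Proof.
move=> [F1 /(_ v) F2] zU.
have dF y : U y -> differentiable F y by move=> /F1[].
have ddF y : U y -> differentiable (fun y => 'D_v F y) y by move=> /F2[].
have zU0 r : 0 <= r <= 1 -> U (z + r *: (s *: v)).
  by move=> r01; have := zU r 0 r01; rewrite scale0r addr0; apply; rewrite lexx ler01.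
have zU1 r : 0 <= r <= 1 -> U (z + r *: (s *: v) + s *: u).
  by move=> r01; have := zU r 1 r01; rewrite scale1r; apply; rewrite lexx ler01.
(* The second difference is the increment of G along s *: v. *)
pose G := (fun y => F (y + s *: u)) - F.
have dG r : 0 <= r <= 1 -> differentiable G (z + r *: (s *: v)).
  move=> r01; apply: differentiableB; last exact/dF/zU0.
  exact/differentiable_shift/dF/zU1.
have [r r01 Er] := mean_value dG.
have {}r01 : 0 <= r <= 1 by case/andP: r01 => *; rewrite !ltW.
have [|r' r01' Er'] := @mean_value (fun y => 'D_v F y) (z + r *: (s *: v)) (s *: u).
  by move=> r' r01'; exact/ddF/zU.
have {}r01' : 0 <= r' <= 1 by case/andP: r01' => *; rewrite !ltW.
exists r, r'; split=> //.
have -> : F (z + s *: v + s *: u) - F (z + s *: v) - F (z + s *: u) + F z =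
    G (z + s *: v) - G z by rewrite /G /= opprB addrA addrAC.
rewrite Er deriveB; last 2 first.
- exact/diff_derivable/differentiable_shift/dF/zU1.
- exact/diff_derivable/dF/zU0.
rewrite derive_shift_arg !deriveZv; [|exact/dF/zU0|exact/dF/zU1].
by rewrite -mulrBr Er' deriveZv ?mulrA//; exact/ddF/zU.
Qed.

(** The second difference over a small parallelogram is symmetric in the two
    directions, and equals the square of the step times either mixed derivative
    at some point of the parallelogram; continuity at z concludes. *)
Lemma schwarz F U z u v : open U -> C2_on U F -> U z ->
  'D_u (fun y => 'D_v F y) z = 'D_v (fun y => 'D_u F y) z.
Proof.
move=> oU F2 Uz; apply/eqP; rewrite -subr_eq0 -normr_eq0.
apply/eqP/le_anti; rewrite normr_ge0 andbT; apply/ler_addgt0Pr => e e0.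
rewrite add0r.
have cD a b : {for z, continuous (fun y => 'D_a (fun y => 'D_b F y) y)}.
  by case: F2 => _ /(_ b)/(_ z Uz)[_ /(_ a)].
have : \forall y \near z, U y /\
   (`|'D_u (fun y => 'D_v F y) z - 'D_u (fun y => 'D_v F y) y| < e / 2 /\
    `|'D_v (fun y => 'D_u F y) z - 'D_v (fun y => 'D_u F y) y| < e / 2).
  apply: filterI; first exact: open_nbhs_nbhs.
  have e20 : 0 < e / 2 by rewrite divr_gt0.
  apply: filterI.
    by have /cvgrPdist_lt/(_ _ e20) := cD u v.
  by have /cvgrPdist_lt/(_ _ e20) := cD v u.
move=> /nbhs_ballP[d /= d0 dP].
have w0 : 0 < `|u| + `|v| + 1 by rewrite ltr_wpDl// addr_ge0.
have [s s0 sd] : exists2 s : R, 0 < s & s * (`|u| + `|v|) < d.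
  exists (d / (`|u| + `|v| + 1)); first by rewrite divr_gt0.
  by rewrite -mulrA gtr_pMr// mulrC ltr_pdivrMr// mul1r ltrDl.
have sP a b r r' : `|a| + `|b| = `|u| + `|v| -> 0 <= r <= 1 -> 0 <= r' <= 1 ->
    ball z d (z + r *: (s *: a) + r' *: (s *: b)).
  move=> ab /andP[r0 r1] /andP[r0' r1']; rewrite -ball_normE /= -addrA opprD addNKr.
  rewrite normrN (le_lt_trans (ler_normD _ _))// !normrZ (gtr0_norm s0).
  rewrite !ger0_norm// (@le_lt_trans _ _ (s * (`|a| + `|b|)))//.
    by rewrite mulrDr lerD// ler_piMl// mulr_ge0// ltW.
  by rewrite ab.
have [|r1 [r1' [h h' E1]]] := @second_difference F U z u v s F2.
  by move=> r r' h h'; apply: (dP _ (sP _ _ _ _ _ _ _)).1 => //; rewrite addrC.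
have [|r2 [r2' [k k' E2]]] := @second_difference F U z v u s F2.
  by move=> r r' k k'; apply: (dP _ (sP _ _ _ _ _ _ _)).1.
have [_ [A _]] := dP _ (sP v u _ _ (addrC _ _) h h').
have [_ [_ B]] := dP _ (sP u v _ _ erefl k k').
have E : 'D_u (fun y => 'D_v F y) (z + r1 *: (s *: v) + r1' *: (s *: u)) =
         'D_v (fun y => 'D_u F y) (z + r2 *: (s *: u) + r2' *: (s *: v)).
  apply: (@mulfI _ (s ^+ 2)); first by rewrite expf_neq0 ?gt_eqF.
  by rewrite -E1 -E2 [z + _ + _]addrAC [X in X + F z]addrAC.
rewrite -E distrC in B.
rewrite (splitr e) (le_trans (ler_distD _ _ _) (lerD (ltW A) (ltW B)))//.
Qed.

End Calculus.

(** * Feasible points in tangent directions *)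

Lemma ler_rV_norm (R : realType) n (c : 'rV[R]_n) (e : R) : 0 <= e ->
  (`|c| <= e) = [forall j, `|c 0 j| <= e].
Proof.
move=> e0; rewrite [in LHS]/Num.Def.normr /= mx_normrE.
apply/bigmax_leP/forallP => [[_ cj] j|cj]; first exact: (cj (0, j)).
by split=> // -[i j] _ /=; rewrite ord1.
Qed.

Lemma rV_coord_le_norm (R : realType) n (c : 'rV[R]_n) j : `|c 0 j| <= `|c|.
Proof.
by move: j; apply/forallP; rewrite -ler_rV_norm.
Qed.

(** Banach's fixed point theorem on a closed ball; the contraction constant
    1/2 is the one that the estimates below provide. *)
Lemma rV_contraction_fixed_point (R : realType) n (T : 'rV[R]_n -> 'rV[R]_n) (e : R) :
  0 <= e -> (forall c, `|c| <= e -> `|T c| <= e) ->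
  (forall c c', `|c| <= e -> `|c'| <= e -> `|T c - T c'| <= 2^-1 * `|c - c'|) ->
  exists2 c, `|c| <= e & T c = c.
Proof.
move=> e0 Te Tlip.
pose X : completeNormedModType R := HB.pack_for (completeNormedModType R) 'rV[R]_n.
pose B : set X := [set c : X | `|c| <= e].
have TB : {homo (T : X -> X) : c / B c} by move=> c; exact: Te.
have ctr : is_contraction (mkfun_fun TB).
  have h0 : (0 : R) <= 2^-1 by [].
  exists (NngNum h0); split => /=; first by rewrite invf_lt1// ltr1n.
  by move=> [c c'] /= [Bc Bc']; exact: Tlip.
have [||c Bc cT] := banach_fixed_point ctr.
- apply: (@closed_comp X R (fun c : X => `|c|) [set r | r <= e]).
    by move=> c _; exact: norm_continuous.
  exact: closed_le.
- by exists 0; rewrite /B /= normr0.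
- by exists c => //; rewrite [RHS]cT.
Qed.

(** A form of Lyusternik's theorem.  The b j are dual to the differentials of
    the h k, so c |-> s^-1 h(z + s (X + sum_j c_j b_j)) is close to the
    identity for small s, and its zeros are the fixed points of a contraction.
    The ball of radius e is preserved because the value at c = 0 tends to
    D_X h = 0. *)
Lemma tangent_direction_lift (R : realType) (V : normedModType R) K
    (h : 'I_K -> V -> R) (U : set V) (z X : V) (b : 'I_K -> V) (e : R) :
  open U -> U z -> (forall k, C1_on U (h k)) -> (forall k, h k z = 0) ->
  (forall k j, 'D_(b j) (h k) z = (k == j)%:R) ->
  (forall k, 'D_X (h k) z = 0) -> 0 < e ->
  \forall s \near 0^'+, exists2 c : 'rV[R]_K, `|c| <= e &
    forall k, h k (z + s *: (X + \sum_j c 0 j *: b j)) = 0.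
Proof.
move=> oU Uz h1 hz bh Xh e0.
pose B (c : 'rV[R]_K) := \sum_j c 0 j *: b j.
have BD c c' r : B (c + r *: c') = B c + r *: B c'.
  rewrite /B scaler_sumr -big_split; apply: eq_bigr => j _.
  by rewrite !mxE scalerDl scalerA.
pose rho := `|X| + \sum_j e * `|b j|.
have rho0 : 0 < rho + 1.
  by rewrite ltr_wpDl// addr_ge0// sumr_ge0// => j _; rewrite mulr_ge0// ltW.
have XB c : `|c| <= e -> `|X + B c| <= rho.
  move=> ce; rewrite (le_trans (ler_normD _ _))// lerD2l.
  rewrite (le_trans (ler_norm_sum _ _ _))// ler_sum// => j _.
  by rewrite normrZ ler_wpM2r// (le_trans (rV_coord_le_norm _ _)).
(* Each of the K coordinates contributes at most eta to the Lipschitz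
   constant of the map below, so the constant is at most 1/2. *)
pose eta : R := (2 * K.+1%:R)^-1.
have eta0 : 0 < eta by rewrite invr_gt0 mulr_gt0.
have : \forall y \near z, U y /\ forall k j, `|(k == j)%:R - 'D_(b j) (h k) y| < eta.
  apply: filterI; first exact: open_nbhs_nbhs.
  apply: filter_forall => k; apply: filter_forall => j.
  have [_ /(_ (b j)) /cvgrPdist_lt/(_ _ eta0)] := h1 k z Uz.
  by apply: filterS => y; rewrite bh.
move=> /nbhs_ballP[d /= d0 dP].
have near1 : \forall s \near 0^'+, forall k, `|s^-1 * h k (z + s *: X)| < e / 2.
  apply: filter_forall => k.
  have dk : differentiable (h k) z by have [] := h1 k z Uz.
  have H : s^-1 * h k (z + s *: X) @[s --> (0 : R)^'+] --> 'D_X (h k) z.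
    have C : (s, X) @[s --> (0 : R)^'+] --> filter_prod (0 : R)^'+ (nbhs X).
      move=> A [[P Q] /= [P0 QX] PQ]; apply: filterS P0 => s Ps.
      by apply: PQ; split=> //=; exact: nbhs_singleton.
    exact: cvg_comp C (hadamard dk (hz k)).
  have e20 : 0 < e / 2 by rewrite divr_gt0.
  move/cvgrPdist_lt/(_ _ e20): H; apply: filterS => s.
  by rewrite Xh sub0r normrN.
near=> s.
have s0 : 0 < s by near: s; exact: nbhs_right_gt.
have sd : s * (rho + 1) < d.
  rewrite -ltr_pdivlMr//; near: s; apply: nbhs_right_lt; exact: divr_gt0.
have sX : forall k, `|s^-1 * h k (z + s *: X)| < e / 2 by near: s.
have pP c : `|c| <= e -> U (z + s *: (X + B c)) /\
    forall k j, `|(k == j)%:R - 'D_(b j) (h k) (z + s *: (X + B c))| < eta.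
  move=> ce; apply: dP; rewrite -ball_normE /= opprD addNKr normrN normrZ.
  rewrite (gtr0_norm s0) (le_lt_trans _ sd)// ler_pM2l//.
  by rewrite (le_trans (XB _ ce))// lerDl.
(* Newton's iteration with the derivative frozen at z, where it is the
   identity in the coordinates c. *)
pose T (c : 'rV[R]_K) : 'rV[R]_K :=
  \row_k (c 0 k - s^-1 * h k (z + s *: (X + B c))).
have Tlip c c' : `|c| <= e -> `|c'| <= e -> `|T c - T c'| <= 2^-1 * `|c - c'|.
  move=> ce c'e; rewrite ler_rV_norm; last by rewrite mulr_ge0.
  apply/forallP => k; rewrite !mxE.
  have conv r : 0 <= r <= 1 -> `|c' + r *: (c - c')| <= e.
    move=> /andP[r0 r1].
    have -> : c' + r *: (c - c') = (1 - r) *: c' + r *: c.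
      by rewrite scalerBr scalerBl scale1r addrCA addrC.
    rewrite (le_trans (ler_normD _ _))// !normrZ (ger0_norm r0) ger0_norm ?subr_ge0//.
    have -> : e = (1 - r) * e + r * e by rewrite -mulrDl subrK mul1r.
    by rewrite lerD// ler_wpM2l// subr_ge0.
  have seg r : z + s *: (X + B c') + r *: (s *: B (c - c')) =
      z + s *: (X + B (c' + r *: (c - c'))).
    by rewrite BD addrA [in RHS]scalerDr -addrA scalerA mulrC -scalerA.
  have seg1 : z + s *: (X + B c') + s *: B (c - c') = z + s *: (X + B c).
    by have := seg 1; rewrite !scale1r [c' + _]addrC subrK.
  have [|r r01] := @mean_value _ _ (h k) (z + s *: (X + B c')) (s *: B (c - c')).
    by move=> r /conv/pP[Uy _]; rewrite seg; have [] := h1 k _ Uy.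
  rewrite seg1 seg => E.
  have {}r01 : 0 <= r <= 1 by case/andP: r01 => *; rewrite !ltW.
  have [Uy Dy] := pP _ (conv r r01).
  have dk := (h1 k _ Uy).1.
  have -> : c 0 k - s^-1 * h k (z + s *: (X + B c)) -
            (c' 0 k - s^-1 * h k (z + s *: (X + B c'))) =
     \sum_j (c - c') 0 j * ((k == j)%:R -
       'D_(b j) (h k) (z + s *: (X + B (c' + r *: (c - c'))))).
    under eq_bigr do rewrite mulrBr; rewrite sumrB.
    rewrite -derive_sumv// -/(B _) (bigD1 k)//= eqxx mulr1 big1 ?addr0; last first.
      by move=> j jk; rewrite eq_sym (negPf jk) mulr0.
    have -> : 'D_(B (c - c')) (h k) (z + s *: (X + B (c' + r *: (c - c')))) =
        s^-1 * (h k (z + s *: (X + B c)) - h k (z + s *: (X + B c'))).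
      by rewrite E deriveZv// mulKf ?gt_eqF.
    by rewrite !mxE; ring.
  rewrite (le_trans (ler_norm_sum _ _ _))//.
  apply: (@le_trans _ _ (\sum_(j < K) `|c - c'| * eta)).
    apply: ler_sum => j _; rewrite normrM ler_pM ?rV_coord_le_norm//.
    exact/ltW/Dy.
  rewrite sumr_const card_ord -mulrnAr mulrC ler_wpM2r//.
  rewrite -mulr_natr /eta ler_pdivrMl ?mulr_gt0//.
  by rewrite mulrAC divff// mul1r ler_nat.
have [|c ce Tc] := @rV_contraction_fixed_point R K T e (ltW e0) _ Tlip.
  move=> c ce; rewrite -[T c](subrK (T 0)) (le_trans (ler_normD _ _))//.
  have n0 : `|(0 : 'rV[R]_K)| <= e by rewrite normr0 ltW.
  rewrite (splitr e) lerD//.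
    by rewrite (le_trans (Tlip _ _ ce n0))// subr0 mulrC ler_pM2r.
  rewrite ler_rV_norm ?divr_ge0 ?ltW//; apply/forallP => k.
  rewrite !mxE sub0r normrN ltW//.
  have -> : B 0 = 0 by rewrite /B big1// => j _; rewrite mxE scale0r.
  by rewrite addr0.
exists c => // k; move/rowP/(_ k) : Tc; rewrite mxE => /eqP.
rewrite -subr_eq0 addrC addKr oppr_eq0 mulf_eq0 invr_eq0 gt_eqF//= => /eqP//.
Unshelve. all: by end_near. Qed.

(** * The second-order necessary condition *)

(** If the second derivative along X were positive, then D_W L(z + s W) would be
    positive for small s and W close to X, since D_v L vanishes at z for every
    v.  Taking for W a direction that leads to a feasible point, the mean
    value theorem makes L larger there than at z.  The function L stands for a
    Lagrangian, which agrees with the objective on the feasible set. *)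
Lemma second_order_necessary (R : realType) (V : normedModType R) K
    (h : 'I_K -> V -> R) (L : V -> R) (U : set V) (z X : V) (b : 'I_K -> V) :
  open U -> U z -> (forall k, C1_on U (h k)) -> (forall k, h k z = 0) ->
  (forall k j, 'D_(b j) (h k) z = (k == j)%:R) ->
  (forall k, 'D_X (h k) z = 0) ->
  C2_on U L -> (forall v, 'D_v L z = 0) ->
  (\forall y \near z, (forall k, h k y = 0) -> L y <= L z) ->
  'D_X (fun y => 'D_X L y) z <= 0.
Proof.
move=> oU Uz h1 hz bh Xh [L1 L2] Lz Lmax; rewrite leNgt; apply/negP => q0.
have dL y : U y -> differentiable L y by move=> /L1[].
have ddL v : differentiable (fun y => 'D_v L y) z by have [] := L2 v z Uz.
pose W (c : 'rV[R]_K) := X + \sum_j c 0 j *: b j.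
have cW : W c @[c --> (0 : 'rV[R]_K)] --> X.
  apply: (cvg_add_small_combination (nbhs_filter (0 : 'rV[R]_K))) => j.
  by have := @coord_continuous R 1 K 0 j (0 : 'rV[R]_K); rewrite /continuous_at mxE.
(* F is the filter of pairs (s, c) with s -> 0+ and c -> 0. *)
pose F := filter_prod (0 : R)^'+ (nbhs (0 : 'rV[R]_K)).
have cF : (p.1, W p.2) @[p --> F] --> filter_prod (0 : R)^'+ (nbhs X).
  move=> A [[P Q] /= [P0 QX] PQ]; exists (P, W @^-1` Q) => /=.
    by split=> //; exact: cW.
  by move=> [s c] /= [Ps Qc]; exact: PQ.
have c1 : p.1 @[p --> F] --> (0 : R).
  move=> A A0; exists (A, setT) => [|[s c] []//].
  by split; [exact: cvg_within A0|exact: filterT].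
have c2 j : (p.2 : 'rV[R]_K) 0 j @[p --> F] --> (0 : R).
  have := @coord_continuous R 1 K 0 j (0 : 'rV[R]_K).
  rewrite /continuous_at mxE; apply: cvg_comp; exact: cvg_snd.
have cz : z + p.1 *: W p.2 @[p --> F] --> z.
  rewrite -[X in _ --> X]addr0 -(scale0r X); apply: cvgD; first exact: cvg_cst.
  apply: cvgZ => //; apply: cvg_comp cW; exact: cvg_snd.
have cD v : p.1^-1 * 'D_v L (z + p.1 *: W p.2) @[p --> F] -->
            'D_(X) (fun y => 'D_v L y) z.
  exact: cvg_comp cF (hadamard (ddL v) (Lz v)).
have cQ : p.1^-1 * 'D_X L (z + p.1 *: W p.2) +
    \sum_j (p.2 : 'rV[R]_K) 0 j * (p.1^-1 * 'D_(b j) L (z + p.1 *: W p.2)) @[p --> F]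
    --> 'D_X (fun y => 'D_X L y) z.
  rewrite -[X in _ --> X]addr0; apply: cvgD; first exact: cD.
  rewrite [X in _ --> X](_ : 0 = \sum_(j < K) 0 * 'D_X (fun y => 'D_(b j) L y) z).
    apply: cvg_sum_fin => j.
    by apply: cvgM; [exact: c2|exact: cD].
  by rewrite big1// => j _; rewrite mul0r.
have [[P Q] /= [P0 Q0] PQ] : F [set p | U (z + p.1 *: W p.2) /\
    (0 < p.1^-1 * 'D_X L (z + p.1 *: W p.2) +
    \sum_j (p.2 : 'rV[R]_K) 0 j * (p.1^-1 * 'D_(b j) L (z + p.1 *: W p.2)) /\
    ((forall k, h k (z + p.1 *: W p.2) = 0) -> L (z + p.1 *: W p.2) <= L z))].
  apply: filterI; first by apply: (cz U); exact: open_nbhs_nbhs.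
  apply: filterI; last exact: (cz _ Lmax).
  by have /cvgr_gt/(_ _ q0) := cQ.
have [d /= d0 dP] := P0.
have /nbhs_ballP[e /= e0 eP] := Q0.
have e20 : 0 < e / 2 by rewrite divr_gt0.
have Hs := tangent_direction_lift oU Uz h1 hz bh Xh e20.
near (0 : R)^'+ => s.
have s0 : 0 < s by near: s; exact: nbhs_right_gt.
have sd : s < d by near: s; exact: nbhs_right_lt.
have [c ce hc] : exists2 c : 'rV[R]_K, `|c| <= e / 2 &
    forall k, h k (z + s *: W c) = 0 by near: s.
have Qc : Q c.
  apply: eP; rewrite -ball_normE /= sub0r normrN (le_lt_trans ce)//.
  by rewrite ltr_pdivrMr// ltr_pMr// ltr1n.
have Pr r : 0 < r <= 1 -> P (r * s).
  move=> /andP[r0 r1]; apply: dP; last by rewrite /= mulr_gt0.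
  rewrite /= sub0r normrN gtr0_norm ?mulr_gt0// (le_lt_trans _ sd)//.
  by rewrite ler_piMl// ltW.
have [_ [_ /(_ hc)]] : [set p | U (z + p.1 *: W p.2) /\
    (0 < p.1^-1 * 'D_X L (z + p.1 *: W p.2) +
    \sum_j (p.2 : 'rV[R]_K) 0 j * (p.1^-1 * 'D_(b j) L (z + p.1 *: W p.2)) /\
    ((forall k, h k (z + p.1 *: W p.2) = 0) -> L (z + p.1 *: W p.2) <= L z))] (s, c).
  by apply: PQ; split=> //=; rewrite -[s]mul1r; apply: Pr; rewrite ltr01 lexx.
rewrite leNgt => /negP; apply; rewrite -subr_gt0.
have seg r : z + r *: (s *: W c) = z + (r * s) *: W c by rewrite scalerA.
have [|r /andP[r0 r1] ->] := @mean_value _ _ L z (s *: W c).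
  move=> r /andP[]; rewrite le_eqVlt => /predU1P[<- _|r0 r1].
    by rewrite scale0r addr0; exact: dL.
  by rewrite seg; apply/dL; apply: (PQ (r * s, c) _).1; split=> //=; apply: Pr; rewrite r0.
have [|/= Ur [pos _]] := PQ (r * s, c).
  by split=> //=; apply: Pr; rewrite r0 ltW.
rewrite seg deriveZv ?mulr_gt0//; last exact: dL.
rewrite deriveDv; last exact: dL.
rewrite derive_sumv; last exact: dL.
rewrite -(pmulr_rgt0 _ (_ : 0 < (r * s)^-1)); last by rewrite invr_gt0 mulr_gt0.
rewrite mulrDr mulr_sumr; under eq_bigr do rewrite mulrCA.
exact: pos.
Unshelve. all: by end_near. Qed.

(** * Lagrangians and the elimination of multipliers *)

Lemma near_eq_differentiable (R : realType) (V W : normedModType R)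
    (f g : V -> W) (z : V) :
  (\forall y \near z, f y = g y) -> differentiable f z -> differentiable g z.
Proof.
move=> fg df; have fgz := nbhs_singleton fg.
have [cf ef] := (diff_locallyP z f).1 df.
have eg : g \o shift z = cst (g z) + 'd f z +o_ (0 : V) id.
  apply/eqaddoP => e e0; have /eqaddoP/(_ _ e0) ef0 := ef.
  have fg0 : \forall h \near (0 : V), f (h + z) = g (h + z).
    have : (fun h : V => h + z) h @[h --> (0 : V)] --> z.
      by rewrite -[X in _ --> X]add0r; apply: cvgD; [exact: cvg_id|exact: cvg_cst].
    by move=> /(_ _ fg).
  apply: filterS2 fg0 ef0 => h fgh.
  suff -> : (g \o shift z - (cst (g z) + 'd f z)) h =
            (f \o shift z - (cst (f z) + 'd f z)) h by [].
  by change (g (h + z) - (g z + 'd f z h) = f (h + z) - (f z + 'd f z h)); rewrite fgh fgz.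
have dg := diff_unique cf eg.
by apply/diff_locallyP; rewrite dg.
Qed.

Section Lagrangian.
Variables (R : realType) (V : normedModType R) (K : nat).
Implicit Types (f F G : V -> R) (g : 'I_K -> V -> R) (c : 'I_K -> R) (U : set V).

Definition lagrangian c f g : V -> R := f + \sum_k c k *: g k.

Lemma lagrangianE c f g z : lagrangian c f g z = f z + \sum_k c k * g k z.
Proof.
rewrite /lagrangian; congr (_ + _); rewrite fct_sumE //.
Qed.

Lemma differentiable_lagrangian c f g z : differentiable f z ->
  (forall k, differentiable (g k) z) -> differentiable (lagrangian c f g) z.
Proof.
move=> df dg; apply: differentiableD => //; apply: differentiable_sum => k.
exact: differentiableZ.
Qed.

Lemma derive_lagrangian c f g z v : differentiable f z ->
  (forall k, differentiable (g k) z) ->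
  'D_v (lagrangian c f g) z = 'D_v f z + \sum_k c k * 'D_v (g k) z.
Proof.
move=> df dg; rewrite deriveD; last 2 first.
- exact: diff_derivable.
- by apply: derivable_sum => k; apply/derivableZ/diff_derivable.
rewrite derive_sum; last by move=> k; apply/derivableZ/diff_derivable.
congr (_ + _); apply: eq_bigr => k _; rewrite deriveZ//; exact: diff_derivable.
Qed.

Lemma C1_on_eq U F G : open U -> (forall z, U z -> F z = G z) ->
  C1_on U F -> C1_on U G.
Proof.
move=> oU FG F1 z Uz; have [dF cF] := F1 z Uz.
have nU : \forall y \near z, U y by exact: open_nbhs_nbhs.
split; first by apply: near_eq_differentiable dF; apply: filterS nU.
move=> v; have E y : U y -> 'D_v F y = 'D_v G y.
  move=> Uy; apply: near_eq_derive; apply: filterS FG _.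
  exact: open_nbhs_nbhs.
suff : 'D_v G y @[y --> z] --> 'D_v G z by [].
rewrite -(E z Uz); apply: cvg_trans (cF v).
by apply: near_eq_cvg; apply: filterS nU.
Qed.

Lemma C1_on_lagrangian U c f g : open U -> C1_on U f -> (forall k, C1_on U (g k)) ->
  C1_on U (lagrangian c f g).
Proof.
move=> oU f1 g1 z Uz; split.
  by apply: differentiable_lagrangian => [|k]; [have [] := f1 z Uz|have [] := g1 k z Uz].
move=> v.
have E y : U y -> 'D_v (lagrangian c f g) y = 'D_v f y + \sum_k c k * 'D_v (g k) y.
  move=> Uy; apply: derive_lagrangian => [|k]; first by have [] := f1 y Uy.
  by have [] := g1 k y Uy.
suff : 'D_v (lagrangian c f g) y @[y --> z] --> 'D_v (lagrangian c f g) z by [].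
rewrite (E z Uz).
have C : 'D_v f y + \sum_k c k * 'D_v (g k) y @[y --> z] -->
    'D_v f z + \sum_k c k * 'D_v (g k) z.
  apply: cvgD; first by have [_ /(_ v)] := f1 z Uz.
  apply: cvg_sum_fin => k; apply: cvgM; first exact: cvg_cst.
  by have [_ /(_ v)] := g1 k z Uz.
apply: cvg_trans C; apply: near_eq_cvg.
apply: filterS (_ : \forall y \near z, U y); last exact: open_nbhs_nbhs.
by move=> y Uy; rewrite E.
Qed.

Lemma C2_on_lagrangian U c f g : open U -> C2_on U f -> (forall k, C2_on U (g k)) ->
  C2_on U (lagrangian c f g).
Proof.
move=> oU [f1 f2] g2; split.
  exact: (C1_on_lagrangian c oU f1 (fun k => (g2 k).1)).
move=> v.
have := C1_on_lagrangian c oU (f2 v) (fun k => (g2 k).2 v).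
apply: C1_on_eq => // z Uz.
rewrite lagrangianE derive_lagrangian//; first exact: (f1 z Uz).1.
by move=> k; exact: ((g2 k).1 z Uz).1.
Qed.

End Lagrangian.

(** By Cramer's rule, det C * (mu q) = (mu C) (adj C) q.  With s a scaling that
    keeps s (mu C) convergent, the right-hand side times s tends to 0 with q,
    however mu behaves. *)
Lemma vanishing_combination (R : realType) (T : Type) (F : set_system T)
    (PF : ProperFilter F) n (C : T -> 'M[R]_n) (mu : T -> 'rV[R]_n)
    (q : T -> 'cV[R]_n) (s : T -> R) (p : 'I_n -> R) (l : R) :
  (forall i j, C t i j @[t --> F] --> (1%:M : 'M[R]_n) i j) ->
  (forall i, q t i 0 @[t --> F] --> (0 : R)) ->
  (forall j, s t * (mu t *m C t) 0 j @[t --> F] --> p j) ->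
  s t * (mu t *m q t) 0 0 @[t --> F] --> l -> l = 0.
Proof.
move=> C1 q0 sC sq.
have E t : \det (C t) * (s t * (mu t *m q t) 0 0) =
    \sum_k \sum_j (s t * (mu t *m C t) 0 j) * (\adj (C t)) j k * q t k 0.
  transitivity (s t * (mu t *m C t *m \adj (C t) *m q t) 0 0).
    by rewrite -[mu t *m _ *m _]mulmxA mul_mx_adj mul_mx_scalar -scalemxAl !mxE; ring.
  rewrite mxE mulr_sumr; apply: eq_bigr => k _.
  rewrite mxE mulr_suml mulr_sumr; apply: eq_bigr => j _; ring.
have L : \det (C t) * (s t * (mu t *m q t) 0 0) @[t --> F] --> \det (1%:M : 'M[R]_n) * l.
  by apply: cvgM => //; exact: cvg_det.
have L0 : \det (C t) * (s t * (mu t *m q t) 0 0) @[t --> F] -->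
    \sum_k \sum_j p j * (\adj (1%:M : 'M[R]_n)) j k * 0.
  under eq_fun do rewrite E.
  apply: cvg_sum_fin => k; apply: cvg_sum_fin => j; apply: cvgM => //.
  by apply: cvgM => //; exact: cvg_adj.
have := cvg_unique (@norm_hausdorff _ _) L L0; rewrite det1 mul1r => ->.
by rewrite big1// => k _; rewrite big1// => j _; rewrite mulr0.
Qed.

(** * Partial derivatives on a product space *)

(** Linearity in the inner direction is reduced to the outer one by symmetry;
    this avoids differentiating an identity that holds only near z. *)
Lemma hessian_bilinear (R : realType) (V : normedModType R) (U : set V)
    (F : V -> R) (z : V) (I : finType) (c : I -> R) (v : I -> V) :
  open U -> C2_on U F -> U z ->
  'D_(\sum_i c i *: v i) (fun y => 'D_(\sum_i c i *: v i) F y) z =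
  \sum_i \sum_j c i * 'D_(v i) (fun y => 'D_(v j) F y) z * c j.
Proof.
move=> oU F2 Uz.
have dd u : differentiable (fun y => 'D_u F y) z by have [_ /(_ u z Uz)[]] := F2.
rewrite derive_sumv//; apply: eq_bigr => i _.
rewrite (schwarz _ _ oU F2 Uz) derive_sumv// mulr_sumr; apply: eq_bigr => j _.
by rewrite (schwarz _ _ oU F2 Uz) mulrAC mulrA.
Qed.

Lemma hessian_linearr (R : realType) (V : normedModType R) (U : set V)
    (F : V -> R) (z w : V) (I : finType) (c : I -> R) (v : I -> V) :
  open U -> C2_on U F -> U z ->
  'D_w (fun y => 'D_(\sum_i c i *: v i) F y) z =
  \sum_i c i * 'D_w (fun y => 'D_(v i) F y) z.
Proof.
move=> oU F2 Uz.
rewrite (schwarz _ _ oU F2 Uz) derive_sumv; last by have [_ /(_ w z Uz)[]] := F2.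
by apply: eq_bigr => i _; rewrite (schwarz _ _ oU F2 Uz).
Qed.

Section Slices.
Variables (R : realType) (V W : normedModType R) (a : W).
Implicit Types (F : V * W -> R) (U : set (V * W)).

Lemma is_diff_pairl (y : V) : is_diff y (fun y => (y, a)) (fun v => (v, 0)).
Proof. exact: (@is_diff_pair _ _ _ _ _ _ _ _ y (is_diff_id y) (is_diff_cst a y)). Qed.

(** This holds with no differentiability assumption, because the difference
    quotients coincide; hence it can be used under another derivative. *)
Lemma derive_slice F (v y : V) :
  'D_v (fun y => F (y, a)) y = 'D_(v, 0) F (y, a).
Proof.
have E (s : R) : (s *: v + y, a) = s *: ((v, 0) : V * W) + (y, a).
  by apply: injective_projections; rewrite /= ?scaler0 ?add0r.
by rewrite /derive /=; under eq_fun do rewrite E.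
Qed.

Lemma derive2_slice F (u v y : V) :
  'D_u (fun y => 'D_v (fun y => F (y, a)) y) y =
  'D_(u, 0) (fun z => 'D_(v, 0) F z) (y, a).
Proof.
rewrite -derive_slice; congr ('D_u _ y).
by apply/funext => y'; rewrite derive_slice.
Qed.

Lemma open_slice U : open U -> open [set y : V | U (y, a)].
Proof.
move=> oU; apply: (@open_comp _ _ (fun y : V => (y, a))) => // y _.
exact/differentiable_continuous/(@ex_diff _ _ _ _ _ _ _ (is_diff_pairl y)).
Qed.

Lemma C1_on_slice U F : C1_on U F ->
  C1_on [set y | U (y, a)] (fun y => F (y, a)).
Proof.
move=> F1 y /= Uy; have [dF cF] := F1 _ Uy.
have dp := @ex_diff _ _ _ _ _ _ _ (is_diff_pairl y).
split; first exact: differentiable_comp dp dF.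
move=> v.
have -> : (fun y => 'D_v (fun y => F (y, a)) y) =
          (fun z => 'D_(v, 0) F z) \o (fun y => (y, a)).
  by apply/funext => y'; rewrite derive_slice.
apply: continuous_comp; first exact: differentiable_continuous.
exact: cF.
Qed.

Lemma C2_on_slice U F : C2_on U F ->
  C2_on [set y | U (y, a)] (fun y => F (y, a)).
Proof.
move=> [F1 F2]; split; first exact: C1_on_slice.
move=> v.
have -> : (fun y => 'D_v (fun y => F (y, a)) y) =
          (fun y => (fun z => 'D_(v, 0) F z) (y, a)).
  by apply/funext => y'; rewrite derive_slice.
exact: (C1_on_slice (F2 (v, 0))).
Qed.

End Slices.

Section Graph.
Variables (R : realType) (V W : normedModType R).

Lemma is_diff_graph (x : V -> W) (F : W * V -> R) (a : V) :
  differentiable x a -> differentiable F (x a, a) ->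
  is_diff a (fun b => F (x b, b)) (fun w => 'D_('D_w x a, w) F (x a, a)).
Proof.
move=> dx dF.
have xg := is_diff_pair (differentiableP dx) (is_diff_id a).
have dg := @ex_diff _ _ _ _ _ _ _ xg.
apply: DiffDef; first exact: (differentiable_comp dg dF).
apply/funext => w; rewrite (diff_comp dg dF) /= (@diff_val _ _ _ _ _ _ _ xg) /=.
by rewrite !deriveE.
Qed.

End Graph.

Section Coordinates.
Variables (R : realType) (M N : nat).
Implicit Types (phi : Defs.point R M N -> R) (z : Defs.point R M N).

Lemma pairl_sum_delta (v : 'rV[R]_M) :
  ((v, 0) : Defs.point R M N) = \sum_i v 0 i *: ((delta_mx 0 i, 0) : Defs.point R M N).
Proof.
have E : {morph (fun y : 'rV[R]_M => (y, 0) : Defs.point R M N) : y y' / y + y'}.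
  by move=> y y'; rewrite -[RHS]/(_, _) addr0.
rewrite {1}(row_sum_delta v) (big_morph _ E (erefl _)).
by apply: eq_bigr => i _; rewrite -[RHS]/(_, _) scaler0.
Qed.

Lemma pairr_sum_delta (w : 'rV[R]_N) :
  ((0, w) : Defs.point R M N) = \sum_mu w 0 mu *: ((0, delta_mx 0 mu) : Defs.point R M N).
Proof.
have E : {morph (fun y : 'rV[R]_N => (0, y) : Defs.point R M N) : y y' / y + y'}.
  by move=> y y'; rewrite -[RHS]/(_, _) addr0.
rewrite {1}(row_sum_delta w) (big_morph _ E (erefl _)).
by apply: eq_bigr => i _; rewrite -[RHS]/(_, _) scaler0.
Qed.

Lemma derive_pairl_partial phi z (v : 'rV[R]_M) : differentiable phi z ->
  'D_((v, 0) : Defs.point R M N) phi z = \sum_i v 0 i * partial_x i phi z.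
Proof. by move=> dphi; rewrite pairl_sum_delta derive_sumv. Qed.

Lemma derive_pairr_partial phi z (w : 'rV[R]_N) : differentiable phi z ->
  'D_((0, w) : Defs.point R M N) phi z = \sum_mu w 0 mu * partial_a mu phi z.
Proof. by move=> dphi; rewrite pairr_sum_delta derive_sumv. Qed.

Lemma partial_decisionE (x : 'rV[R]_N -> 'rV[R]_M) i mu a : differentiable x a ->
  partial_decision x i mu a = ('D_(delta_mx 0 mu) x a) 0 i.
Proof.
move=> dx; rewrite /partial_decision.
have /cvg_ex[l xl] := @diff_derivable _ _ _ x a (delta_mx 0 mu) dx.
rewrite [in RHS]/derive (cvg_lim _ xl)//.
apply: cvg_lim => //.
have := cvg_comp _ _ xl (@coord_continuous R 1 M 0 i l).
apply: cvg_trans; apply: near_eq_cvg; apply: nearW => s /=.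
by rewrite !mxE.
Qed.

Lemma gcd_decisionE A (t : 'I_A -> Defs.point R M N -> 'rV[R]_N)
    (x : 'rV[R]_N -> 'rV[R]_M) i al a : differentiable x a ->
  gcd_decision t x i al a = ('D_(t al (x a, a)) x a) 0 i.
Proof.
move=> dx; rewrite deriveE// {1}(row_sum_delta (t al _)) linear_sum summxE.
apply: eq_bigr => mu _; rewrite partial_decisionE// deriveE//.
by rewrite linearZ mxE.
Qed.

End Coordinates.

(** * The differentiated first-order condition and the entries of Omega *)

Section Stationarity.
Variables (R : realType) (M N K : nat).
Variables (P : set 'rV[R]_N) (openP : open P) (D : set 'rV[R]_M).
Variables (U : set (Defs.point R M N)) (openU : open U) (subU : D `*` P `<=` U).
Variables (f : Defs.point R M N -> R) (g : 'I_K -> Defs.point R M N -> R).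
Hypotheses (f_C2 : C2_on U f) (g_C2 : forall k, C2_on U (g k)).
Variables (x : 'rV[R]_N -> 'rV[R]_M) (x_C1 : C1_on P x).
Hypotheses (x_in : forall a, P a -> D (x a)).
Hypotheses (gx : forall a, P a -> forall k, g k (x a, a) = 0).
Variables (lam : 'rV[R]_N -> 'I_K -> R).
Hypothesis lamP : forall a, P a -> multipliers f g x lam a.
Variables (a : 'rV[R]_N) (Pa : P a).
Let z := (x a, a).
Let L := lagrangian (lam a) f g.
Let dirx (v : 'rV[R]_M) : Defs.point R M N := (v, 0).
Let dira (w : 'rV[R]_N) : Defs.point R M N := (0, w).
Let X (w : 'rV[R]_N) := 'D_w x a.

Let Ux b : P b -> U (x b, b).
Proof. by move=> Pb; apply: subU; split=> //; exact: x_in. Qed.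

Let df b : P b -> differentiable f (x b, b).
Proof. by move=> /Ux/f_C2.1[]. Qed.

Let dg b k : P b -> differentiable (g k) (x b, b).
Proof. by move=> /Ux/(g_C2 k).1[]. Qed.

Let dx : differentiable x a. Proof. exact: (x_C1 Pa).1. Qed.

(** The first-order condition at a nearby parameter b, for the Lagrangian whose
    multipliers are those of a. *)
Lemma derive_lagrangian_graph b v : P b ->
  'D_(dirx v) L (x b, b) =
  \sum_k (lam a k - lam b k) * 'D_(dirx v) (g k) (x b, b).
Proof.
move=> Pb; rewrite derive_lagrangian; [|exact: df|by move=> k; exact: dg].
have -> : 'D_(dirx v) f (x b, b) = - \sum_k lam b k * 'D_(dirx v) (g k) (x b, b).
  rewrite derive_pairl_partial; last exact: df.
  under eq_bigr do rewrite lamP// mulrN mulr_sumr.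
  rewrite sumrN exchange_big; congr (- _); apply: eq_bigr => k _.
  rewrite derive_pairl_partial; last exact: dg.
  by rewrite mulr_sumr; apply: eq_bigr => i _; rewrite mulrCA.
by rewrite addrC -sumrB; apply: eq_bigr => k _; rewrite mulrBl.
Qed.

Lemma lagrangian_stationary v : 'D_(dirx v) L z = 0.
Proof.
by rewrite derive_lagrangian_graph// big1// => k _; rewrite subrr mul0r.
Qed.

Lemma constraint_total_derivative k w : 'D_(X w, w) (g k) z = 0.
Proof.
have dgk := is_diff_graph dx (dg k Pa).
transitivity ('D_w (fun b => g k (x b, b)) a).
  rewrite [RHS]deriveE; last exact: (@ex_diff _ _ _ _ _ _ _ dgk).
  by rewrite (@diff_val _ _ _ _ _ _ _ dgk).
rewrite (@near_eq_derive _ _ _ _ (cst 0)); first by rewrite derive_cst.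
apply: filterS (_ : \forall b \near a, P b); last exact: open_nbhs_nbhs.
by move=> b Pb; exact: gx.
Qed.

Let L2 : C2_on U L. Proof. exact: C2_on_lagrangian. Qed.

Let dDL u : differentiable (fun y => 'D_u L y) z.
Proof. exact: (L2.2 u z (Ux Pa)).1. Qed.

(** Total derivative along w of the first-order condition paired with a tangent
    v.  At a parameter b near a, D_v L is the combination of the D_v g^k with
    coefficients lam(a) - lam(b).  Pairing with the b j instead of v gives these
    coefficients times a matrix that tends to the identity, and has convergent
    difference quotients, so [vanishing_combination] applies. *)
Lemma differentiated_stationarity (b : 'I_K -> 'rV[R]_M) (v : 'rV[R]_M) w :
  (forall k j, 'D_(dirx (b j)) (g k) z = (k == j)%:R) ->
  (forall k, 'D_(dirx v) (g k) z = 0) ->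
  'D_(X w, w) (fun y => 'D_(dirx v) L y) z = 0.
Proof.
move=> gb gv.
pose l u (c : 'rV[R]_N) := 'D_(dirx u) L (x c, c).
have la u : l u a = 0 by exact: lagrangian_stationary.
pose y (s : R) := s *: w + a.
have ya : y s @[s --> 0^'] --> a.
  rewrite -[X in _ --> X]add0r; apply: cvgD; last exact: cvg_cst.
  by rewrite -(scale0r w); apply: cvgZr_tmp; exact: (@cvg_within _ (nbhs (0 : R))).
have nP : \forall s \near 0^', P (y s).
  by apply: ya; exact: open_nbhs_nbhs.
have lD u : s^-1 * l u (y s) @[s --> 0^'] --> 'D_(X w, w) (fun y => 'D_(dirx u) L y) z.
  have dl := is_diff_graph dx (dDL (dirx u)).
  have dl' := @ex_diff _ _ _ _ _ _ _ dl.
  have <- : 'D_w (l u) a = 'D_(X w, w) (fun y => 'D_(dirx u) L y) z.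
    by rewrite deriveE// (@diff_val _ _ _ _ _ _ _ dl).
  have /cvg_ex[r lr] := @diff_derivable _ _ _ (l u) a w dl'.
  rewrite /derive (cvg_lim _ lr)//; apply: cvg_trans lr.
  by apply: near_eq_cvg; apply: nearW => s /=; rewrite la subr0.
have gD k u : 'D_(dirx u) (g k) (x (y s), y s) @[s --> 0^'] --> 'D_(dirx u) (g k) z.
  have [_ /(_ (dirx u)) cg] := (g_C2 k).1 _ (Ux Pa).
  have xg := is_diff_pair (differentiableP dx) (is_diff_id a).
  have cxg := differentiable_continuous (@ex_diff _ _ _ _ _ _ _ xg).
  exact: (cvg_comp _ _ (cvg_comp _ _ ya cxg) cg).
pose C s : 'M[R]_K := \matrix_(k, j) 'D_(dirx (b j)) (g k) (x (y s), y s).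
pose q s : 'cV[R]_K := \col_k 'D_(dirx v) (g k) (x (y s), y s).
pose mu s : 'rV[R]_K := \row_k (lam a k - lam (y s) k).
apply: (@vanishing_combination R R 0^' _ K C mu q (fun s => s^-1)
  (fun j => 'D_(X w, w) (fun y => 'D_(dirx (b j)) L y) z)).
- move=> k j; have := gD k (b j); rewrite gb mxE; apply: cvg_trans.
  by apply: near_eq_cvg; apply: nearW => s; rewrite mxE.
- move=> k; have := gD k v; rewrite gv; apply: cvg_trans.
  by apply: near_eq_cvg; apply: nearW => s; rewrite mxE.
- move=> j; apply: cvg_trans (lD (b j)); apply: near_eq_cvg.
  apply: filterS nP => s Ps; rewrite /l derive_lagrangian_graph// mxE; congr (_ * _).
  by apply: eq_bigr => k _; rewrite !mxE.
- apply: cvg_trans (lD v); apply: near_eq_cvg.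
  apply: filterS nP => s Ps; rewrite /l derive_lagrangian_graph// mxE; congr (_ * _).
  by apply: eq_bigr => k _; rewrite !mxE.
Qed.

Section Isovectors.
Variables (A : nat) (t : 'I_A -> Defs.point R M N -> 'rV[R]_N).
Hypothesis t_orth : forall al k, dotv (t al z) (grad_a (g k) z) = 0.

Let split_dir w : ((X w, w) : Defs.point R M N) = dirx (X w) + dira w.
Proof. by apply: injective_projections; rewrite /= ?addr0 ?add0r. Qed.

(** Along an isovector the constraints do not change through the parameters, so
    the response of the decision cannot change them either. *)
Lemma isovector_response_tangent al k : 'D_(dirx (X (t al z))) (g k) z = 0.
Proof.
have := constraint_total_derivative k (t al z).
rewrite split_dir deriveDv; last exact: dg.
suff -> : 'D_(dira (t al z)) (g k) z = 0 by rewrite addr0.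
rewrite derive_pairr_partial; last exact: dg.
by rewrite -[RHS](t_orth al k); apply: eq_bigr => mu _; rewrite mxE.
Qed.

Lemma Omega_bracket al i :
  gcd_partial t al (partial_x i f) z +
    \sum_(k < K) lam a k * gcd_partial t al (partial_x i (g k)) z =
  'D_(dira (t al z)) (fun y => 'D_(dirx (delta_mx 0 i)) L y) z.
Proof.
have ddf : differentiable (partial_x i f) z by exact: (f_C2.2 _ z (Ux Pa)).1.
have ddg k : differentiable (partial_x i (g k)) z.
  by exact: ((g_C2 k).2 _ z (Ux Pa)).1.
have -> : 'D_(dira (t al z)) (fun y => 'D_(dirx (delta_mx 0 i)) L y) z =
    'D_(dira (t al z)) (lagrangian (lam a) (partial_x i f)
                          (fun k => partial_x i (g k))) z.
  apply: near_eq_derive.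
  apply: filterS (_ : \forall y \near z, U y).
    move=> y Uy; rewrite lagrangianE derive_lagrangian//; first exact: (f_C2.1 y Uy).1.
    by move=> k; exact: ((g_C2 k).1 y Uy).1.
  by apply: open_nbhs_nbhs; split => //; exact: Ux.
rewrite derive_lagrangian// derive_pairr_partial//; congr (_ + _).
by apply: eq_bigr => k _; rewrite derive_pairr_partial.
Qed.

(** Omega is the mixed derivative of L along an isovector and a response; the
    differentiated first-order condition trades the isovector for minus the
    response that it causes. *)
Lemma Omega_hessian (b : 'I_K -> 'rV[R]_M) al be :
  (forall k j, 'D_(dirx (b j)) (g k) z = (k == j)%:R) ->
  Omega f g t x lam a al be =
  - 'D_(dirx (X (t al z))) (fun y => 'D_(dirx (X (t be z))) L y) z.
Proof.
move=> gb; rewrite mxE.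
under eq_bigr do rewrite gcd_decisionE// Omega_bracket.
have X0 := differentiated_stationarity (t al z) gb (isovector_response_tangent be).
pose u := X (t be z).
have Xs := deriveDv (dirx (X (t al z))) (dira (t al z)) (dDL (dirx u)).
have Eu : 'D_(dira (t al z)) (fun y => 'D_(dirx u) L y) z =
    \sum_i u 0 i * 'D_(dira (t al z)) (fun y => 'D_(dirx (delta_mx 0 i)) L y) z.
  have Hu := hessian_linearr (dira (t al z)) (fun i => u 0 i)
    (fun i => dirx (delta_mx 0 i)) openU L2 (Ux Pa).
  have Du := congr1 (fun d => 'D_(dira (t al z)) (fun y => 'D_d L y) z)
    (pairl_sum_delta N u).
  exact: etrans Du Hu.
have opp_sum0 (p q : R) : p + q = 0 -> q = - p.
  by move=> /eqP; rewrite addrC addr_eq0 => /eqP.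
apply: etrans (esym Eu) _; apply: opp_sum0; apply: etrans (esym Xs) _.
exact: etrans (congr1 (fun d => 'D_d (fun y => 'D_(dirx u) L y) z)
                 (esym (split_dir (t al z)))) X0.
Qed.

End Isovectors.

End Stationarity.

(** * Symmetry and semidefiniteness *)

Theorem theorem1 (R : realType) (M N K A : nat)
  (ltKM : (K < M)%N) (ltKN : (K < N)%N)
  (P : set 'rV[R]_N) (openP : open P)
  (D : set 'rV[R]_M)
  (U : set ('rV[R]_M * 'rV[R]_N)) (openU : open U) (subU : D `*` P `<=` U)
  (f : 'rV[R]_M * 'rV[R]_N -> R) (g : 'I_K -> 'rV[R]_M * 'rV[R]_N -> R)
  (f_C2 : C2_on U f) (g_C2 : forall k, C2_on U (g k))
  (x : 'rV[R]_N -> 'rV[R]_M) (x_C1 : C1_on P x)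
  (x_int : forall a, P a -> interior D (x a))
  (x_opt : forall a, P a -> unique_solution D f g a (x a))
  (indep_a : forall a, P a -> row_free (\matrix_(k < K) grad_a (g k) (x a, a)))
  (indep_x : forall a, P a -> row_free (\matrix_(k < K) grad_x (g k) (x a, a)))
  (lam : 'rV[R]_N -> 'I_K -> R)
  (lamP : forall a, P a -> multipliers f g x lam a)
  (t : 'I_A -> 'rV[R]_M * 'rV[R]_N -> 'rV[R]_N)
  (tP : forall z, (D `*` P) z -> isovectors g t z)
  (a : 'rV[R]_N) (Pa : P a) :
  [/\ (Omega f g t x lam a)^T = Omega f g t x lam a,
      forall eta : 'rV[R]_A,
        0 <= \sum_(al < A) \sum_(be < A)
               eta 0 al * Omega f g t x lam a al be * eta 0 be
    & comparative_statics_matrix x a (Omega f g t x lam a)].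
Proof.
have x_in b : P b -> D (x b) by move=> /x_int; exact: interior_subset.
have gx b : P b -> forall k, g k (x b, b) = 0 by move=> /x_opt[[[_]]].
have Uxa : U (x a, a) by apply: subU; split => //; exact: x_in.
have t_orth al k : dotv (t al (x a, a)) (grad_a (g k) (x a, a)) = 0.
  by have [] := tP (x a, a) (conj (x_in a Pa) Pa).
pose L y := lagrangian (lam a) f g (y, a).
pose G k y := g k (y, a).
pose Ua := [set y | U (y, a)].
have oUa : open Ua by exact: open_slice.
have L2 : C2_on Ua L by exact/C2_on_slice/C2_on_lagrangian.
have G1 k : C1_on Ua (G k) by apply: C1_on_slice; exact: (g_C2 k).1.
have dG k : differentiable (G k) (x a) by exact: (G1 k _ Uxa).1.
(* A right inverse of the Jacobian supplies decision directions dual to the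
   constraint gradients. *)
have [B GB] := row_freeP (indep_x a Pa).
pose b j : 'rV[R]_M := (col j B)^T.
have gb k j : 'D_((b j, 0) : 'rV[R]_M * 'rV[R]_N) (g k) (x a, a) = (k == j)%:R.
  rewrite derive_pairl_partial; last exact: ((g_C2 k).1 _ Uxa).1.
  have /matrixP/(_ k j) := GB; rewrite !mxE => <-.
  by apply: eq_bigr => i _; rewrite !mxE mulrC.
have [X tanX OmE] : exists2 X : 'I_A -> 'rV[R]_M,
    forall al k, 'D_(X al) (G k) (x a) = 0
  & forall al be, Omega f g t x lam a al be =
      - 'D_(X al) (fun y => 'D_(X be) L y) (x a).
  exists (fun al => 'D_(t al (x a, a)) x a) => [al k|al be].
    rewrite derive_slice.
    exact: (isovector_response_tangent openP subU g_C2 x_C1 x_in gx Pa t_orth).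
  rewrite derive2_slice.
  exact: (Omega_hessian openP openU subU f_C2 g_C2 x_C1 x_in gx lamP Pa t_orth al be gb).
have sym : (Omega f g t x lam a)^T = Omega f g t x lam a.
  by apply/matrixP => al be; rewrite [LHS]mxE !OmE (schwarz _ _ oUa L2 Uxa).
have psd : possemidef (Omega f g t x lam a).
  move=> eta; pose Y : 'rV[R]_M := \sum_al eta 0 al *: X al.
  have -> : \sum_(al < A) \sum_(be < A)
      eta 0 al * Omega f g t x lam a al be * eta 0 be =
      - 'D_Y (fun y => 'D_Y L y) (x a).
    rewrite (hessian_bilinear _ _ oUa L2 Uxa) -sumrN; apply: eq_bigr => al _.
    by rewrite -sumrN; apply: eq_bigr => be _; rewrite OmE mulrN mulNr.
  rewrite oppr_ge0; apply: (@second_order_necessary R _ K G L Ua (x a) Y b) => //.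
  - by move=> k; exact: gx.
  - by move=> k j; rewrite derive_slice.
  - move=> k; rewrite derive_sumv// big1// => al _.
    by rewrite tanX mulr0.
  - move=> v; rewrite derive_slice.
    exact: (lagrangian_stationary subU f_C2 g_C2 x_in lamP Pa v).
  - apply: filterS (x_int a Pa) => y Dy gy.
    have [[_ fmax] _] := x_opt a Pa.
    have Lf y' : (forall k, G k y' = 0) -> L y' = f (y', a).
      move=> gy'; rewrite [LHS]lagrangianE big1 ?addr0// => k _.
      by rewrite [X in _ * X]gy' mulr0.
    rewrite (Lf _ gy) (Lf _ (gx a Pa)); exact: fmax.
split=> //; split=> //; last by left.
exists (fun al be i mu => t be (x a, a) 0 mu *
  (gcd_partial t al (partial_x i f) (x a, a) +
     \sum_(k < K) lam a k * gcd_partial t al (partial_x i (g k)) (x a, a))).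
move=> al be; rewrite mxE; apply: eq_bigr => i _.
by rewrite mulr_suml; apply: eq_bigr => mu _; rewrite mulrAC.
Qed.
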